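(* Let $\mathcal T$ be a double groupoid with boxes $\mathcal B$, horizontal edges $\mathcal H$, vertical edges $\mathcal V$ and points $\mathcal P$. The following are equivalent. (1) $\mathcal T$ is vacant: for all $g\in\mathcal V$, $x\in\mathcal H$ with $r(x)=t(g)$ there is exactly one $X\in\mathcal B$ with $t(X)=x$ and $r(X)=g$. (2) For all $R,S,P\in\mathcal B$ such that $b(R)=t(S)$ and $r(P)=l(R\circ_v S)$, there exist unique $X,Y\in\mathcal B$ such that $r(X)=l(R)$, $r(Y)=l(S)$, $b(X)=t(Y)$ and $P=X\circ_v Y$. (3) For any $f\in\mathcal V$, $y\in\mathcal H$ such that $l(y)=b(f)$, there is exactly one $Z\in\mathcal B$ with $l(Z)=f$ and $b(Z)=y$. (4) For all $T,U,Q\in\mathcal B$ such that $r(T)=l(U)$ and $b(Q)=t(TU)$, there exist unique $V,Z\in\mathcal B$ such that $b(V)=t(T)$, $b(Z)=t(U)$, $r(V)=l(Z)$ and $Q=VZ$. (5) For any $f\in\mathcal V$, $x\in\mathcal H$ such that $l(x)=t(f)$, there is exactly one $Z\in\mathcal B$ with $l(Z)=f$ and $t(Z)=x$. (6) For any $g\in\mathcal V$, $y\in\mathcal H$ such that $r(y)=b(g)$, there is exactly one $Z\in\mathcal B$ with $r(Z)=g$ and $b(Z)=y$.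
   Context: Convention: in a category, $fg$ means ''first $f$, then $g$'' (defined when target of $f$ = source of $g$). Double categories. A (small) double category $\mathcal T$ consists of non-empty sets $\mathcal B$ (boxes), $\mathcal H$ (horizontal edges), $\mathcal V$ (vertical edges), $\mathcal P$ (points) and four categories: (arrows $\mathcal B$, objects $\mathcal H$, source $t$, target $b$), whose composition is called vertical; (arrows $\mathcal B$, objects $\mathcal V$, source $l$, target $r$), whose composition is called horizontal; (arrows $\mathcal H$, objects $\mathcal P$, source $l$, target $r$); (arrows $\mathcal V$, objects $\mathcal P$, source $t$, target $b$). Write $A\circ_v B$ ($A$ on top of $B$) for the vertical composite, defined when $b(A)=t(B)$, and $AB$ for the horizontal composite, defined when $r(A)=l(B)$. Write $\mathrm{id}_P$ for the identities in $\mathcal H$ and in $\mathcal V$ at $P\in\mathcal P$; for $x\in\mathcal H$, $\mathbf{id}_x\in\mathcal B$ is the identity of $x$ for vertical composition; for $g\in\mathcal V$, $\mathbf{id}_g\in\mathcal B$ is the identity of $g$ for horizontal composition. Axioms: (1) $tr=rt$, $tl=lt$, $bl=lb$, $br=rb$ as maps $\mathcal B\to\mathcal P$; (2) $t(AB)=t(A)t(B)$, $b(AB)=b(A)b(B)$, $l(A\circ_v B)=l(A)l(B)$, $r(A\circ_v B)=r(A)r(B)$; (3) interchange: $(AB)\circ_v(CD)=(A\circ_v C)(B\circ_v D)$ whenever $r(A)=l(B)$, $r(C)=l(D)$, $b(A)=t(C)$, $b(B)=t(D)$; (4) for $x\in\mathcal H$, $l(\mathbf{id}_x)=\mathrm{id}_{l(x)}$,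 $r(\mathbf{id}_x)=\mathrm{id}_{r(x)}$; for $g\in\mathcal V$, $t(\mathbf{id}_g)=\mathrm{id}_{t(g)}$, $b(\mathbf{id}_g)=\mathrm{id}_{b(g)}$; (5) for $P\in\mathcal P$ the vertical identity of the horizontal edge $\mathrm{id}_P$ equals the horizontal identity of the vertical edge $\mathrm{id}_P$; (6) $\mathbf{id}_g\circ_v\mathbf{id}_h=\mathbf{id}_{gh}$ for composable $g,h\in\mathcal V$ and $\mathbf{id}_x\mathbf{id}_y=\mathbf{id}_{xy}$ for composable $x,y\in\mathcal H$. A double groupoid is a double category all four of whose categories are groupoids. *)

(* Defs.v *)
From mathcomp Require Import all_boot.

Set Implicit Arguments.
Unset Strict Implicit.
Unset Printing Implicit Defensive.

(* Arrows-only small categories.  [comp f g _] is "first f, then g".  Composition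
   is genuinely partial: it takes a proof of composability, and every axiom
   mentioning a composite holds for all such proofs. *)
Record category (A O : Type) := Category {
  src : A -> O;
  tgt : A -> O;
  idn : O -> A;
  comp : forall f g : A, tgt f = src g -> A;
  src_idn : forall x, src (idn x) = x;
  tgt_idn : forall x, tgt (idn x) = x;
  src_comp : forall f g (fg : tgt f = src g), src (comp fg) = src f;
  tgt_comp : forall f g (fg : tgt f = src g), tgt (comp fg) = tgt g;
  comp_idl : forall f (e : tgt (idn (src f)) = src f), comp e = f;
  comp_idr : forall f (e : tgt f = src (idn (tgt f))), comp e = f;
  comp_assoc : forall f g h (fg : tgt f = src g) (gh : tgt g = src h)
      (fg_h : tgt (comp fg) = src h) (f_gh : tgt f = src (comp gh)),
    comp fg_h = comp f_gh
}.

Arguments src {A O} c f.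
Arguments tgt {A O} c f.
Arguments idn {A O} c x.
Arguments comp {A O} c f g fg.

Definition is_groupoid (A O : Type) (C : category A O) : Prop :=
  forall f : A, exists (g : A) (fg : tgt C f = src C g) (gf : tgt C g = src C f),
    comp C f g fg = idn C (src C f) /\ comp C g f gf = idn C (tgt C f).

Record double_data := DoubleData {
  box : Type;
  hedge : Type;
  vedge : Type;
  point : Type;
  vcat : category box hedge;
  hcat : category box vedge;
  hedge_cat : category hedge point;
  vedge_cat : category vedge point
}.

Section DoubleDataNotions.
Variable D : double_data.

Definition box_t (X : box D) : hedge D := src (vcat D) X.
Definition box_b (X : box D) : hedge D := tgt (vcat D) X.
Definition box_l (X : box D) : vedge D := src (hcat D) X.
Definition box_r (X : box D) : vedge D := tgt (hcat D) X.
Definition hedge_l (x : hedge D) : point D := src (hedge_cat D) x.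
Definition hedge_r (x : hedge D) : point D := tgt (hedge_cat D) x.
Definition vedge_t (g : vedge D) : point D := src (vedge_cat D) g.
Definition vedge_b (g : vedge D) : point D := tgt (vedge_cat D) g.

(* [vcomp X Y _] is X on top of Y; [hcomp X Y _] is X to the left of Y. *)
Definition vcomp (X Y : box D) (e : box_b X = box_t Y) : box D :=
  comp (vcat D) X Y e.
Definition hcomp (X Y : box D) (e : box_r X = box_l Y) : box D :=
  comp (hcat D) X Y e.
Definition hedge_comp (x y : hedge D) (e : hedge_r x = hedge_l y) : hedge D :=
  comp (hedge_cat D) x y e.
Definition vedge_comp (g h : vedge D) (e : vedge_b g = vedge_t h) : vedge D :=
  comp (vedge_cat D) g h e.

Definition id_box_h (x : hedge D) : box D := idn (vcat D) x.
Definition id_box_v (g : vedge D) : box D := idn (hcat D) g.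
Definition id_hedge (p : point D) : hedge D := idn (hedge_cat D) p.
Definition id_vedge (p : point D) : vedge D := idn (vedge_cat D) p.

End DoubleDataNotions.

Arguments vcomp {D} X Y e.
Arguments hcomp {D} X Y e.
Arguments hedge_comp {D} x y e.
Arguments vedge_comp {D} g h e.

Record is_double_category (D : double_data) : Prop := IsDoubleCategory {
  box_inhabited : inhabited (box D);
  hedge_inhabited : inhabited (hedge D);
  vedge_inhabited : inhabited (vedge D);
  point_inhabited : inhabited (point D);
  corner_tr : forall X : box D, vedge_t (box_r X) = hedge_r (box_t X);
  corner_tl : forall X : box D, vedge_t (box_l X) = hedge_l (box_t X);
  corner_bl : forall X : box D, vedge_b (box_l X) = hedge_l (box_b X);
  corner_br : forall X : box D, vedge_b (box_r X) = hedge_r (box_b X);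
  box_t_hcomp : forall (X Y : box D) (e : box_r X = box_l Y)
      (e' : hedge_r (box_t X) = hedge_l (box_t Y)),
    box_t (hcomp X Y e) = hedge_comp (box_t X) (box_t Y) e';
  box_b_hcomp : forall (X Y : box D) (e : box_r X = box_l Y)
      (e' : hedge_r (box_b X) = hedge_l (box_b Y)),
    box_b (hcomp X Y e) = hedge_comp (box_b X) (box_b Y) e';
  box_l_vcomp : forall (X Y : box D) (e : box_b X = box_t Y)
      (e' : vedge_b (box_l X) = vedge_t (box_l Y)),
    box_l (vcomp X Y e) = vedge_comp (box_l X) (box_l Y) e';
  box_r_vcomp : forall (X Y : box D) (e : box_b X = box_t Y)
      (e' : vedge_b (box_r X) = vedge_t (box_r Y)),
    box_r (vcomp X Y e) = vedge_comp (box_r X) (box_r Y) e';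
  interchange : forall (X Y Z W : box D)
      (XY : box_r X = box_l Y) (ZW : box_r Z = box_l W)
      (XZ : box_b X = box_t Z) (YW : box_b Y = box_t W)
      (XY_ZW : box_b (hcomp X Y XY) = box_t (hcomp Z W ZW))
      (XZ_YW : box_r (vcomp X Z XZ) = box_l (vcomp Y W YW)),
    vcomp (hcomp X Y XY) (hcomp Z W ZW) XY_ZW
    = hcomp (vcomp X Z XZ) (vcomp Y W YW) XZ_YW;
  box_l_id : forall x : hedge D, box_l (id_box_h x) = id_vedge (hedge_l x);
  box_r_id : forall x : hedge D, box_r (id_box_h x) = id_vedge (hedge_r x);
  box_t_id : forall g : vedge D, box_t (id_box_v g) = id_hedge (vedge_t g);
  box_b_id : forall g : vedge D, box_b (id_box_v g) = id_hedge (vedge_b g);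
  id_box_point : forall p : point D,
    id_box_h (id_hedge p) = id_box_v (id_vedge p);
  vcomp_id_box : forall (g h : vedge D) (e : vedge_b g = vedge_t h)
      (e' : box_b (id_box_v g) = box_t (id_box_v h)),
    vcomp (id_box_v g) (id_box_v h) e' = id_box_v (vedge_comp g h e);
  hcomp_id_box : forall (x y : hedge D) (e : hedge_r x = hedge_l y)
      (e' : box_r (id_box_h x) = box_l (id_box_h y)),
    hcomp (id_box_h x) (id_box_h y) e' = id_box_h (hedge_comp x y e)
}.

Record double_category := DoubleCategory {
  double_category_data :> double_data;
  double_categoryP : is_double_category double_category_data
}.

Record double_groupoid := DoubleGroupoid {
  double_groupoid_category :> double_category;
  vcat_groupoid : is_groupoid (vcat double_groupoid_category);
  hcat_groupoid : is_groupoid (hcat double_groupoid_category);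
  hedge_groupoid : is_groupoid (hedge_cat double_groupoid_category);
  vedge_groupoid : is_groupoid (vedge_cat double_groupoid_category)
}.

Definition vacant (T : double_groupoid) : Prop :=
  forall (g : vedge T) (x : hedge T), hedge_r x = vedge_t g ->
    exists! X : box T, box_t X = x /\ box_r X = g.

(* Main.v *)
From mathcomp Require Import all_boot.
Require Import Defs.

(** Inverting boxes horizontally or vertically carries each of the four
corner-filling conditions (1), (3), (5), (6) to another one.  Transposition
(exchanging horizontal and vertical) swaps (2) with (4) and (1) with (3), and
fixes (5) and (6).  So it suffices to prove two implications.
If [T] is vacant, a vertical factorization [P = X o Y] as in (2) is forced:
[X] is the box with top [t(P)] and right edge [l(R)], and [Y = X^-1 o P].
Conversely, (2) applied to [R = id_(g^-1)], [S = id_g] and [P = id_y] says that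
[id_y] factors uniquely as [X o Y] with [r(Y) = g]; such [Y] are exactly the
boxes with right edge [g] and bottom [y], since [X] must be [Y^-1]. *)

Set Implicit Arguments.
Unset Strict Implicit.
Unset Printing Implicit Defensive.

Section Inverse.
Variables (A O : Type) (C : category A O).

(** Shaped so that [is_groupoid C] unfolds to the existence of an [inverse] for every arrow. *)
Definition inverse (f g : A) : Prop :=
  exists (fg : tgt C f = src C g) (gf : tgt C g = src C f),
    comp C f g fg = idn C (src C f) /\ comp C g f gf = idn C (tgt C f).

Lemma comp_idn_r f x (e : tgt C f = src C (idn C x)) : comp C f (idn C x) e = f.
Proof.
have ex : x = tgt C f by rewrite e src_idn.
by subst x; apply: comp_idr.
Qed.

Lemma comp_idn_l f x (e : tgt C (idn C x) = src C f) : comp C (idn C x) f e = f.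
Proof.
have ex : x = src C f by rewrite -e tgt_idn.
by subst x; apply: comp_idl.
Qed.

(* Both sides equal [f (g id)], with the same composability proofs. *)
Lemma comp_irrelevance f g (e e' : tgt C f = src C g) :
  comp C f g e = comp C f g e'.
Proof.
have gi : tgt C g = src C (idn C (tgt C g)) by rewrite src_idn.
have f_gi : tgt C f = src C (comp C g _ gi) by rewrite src_comp.
have reassoc e0 : comp C f g e0 = comp C f _ f_gi.
  have fg_i : tgt C (comp C f g e0) = src C (idn C (tgt C g)).
    by rewrite tgt_comp src_idn.
  by rewrite -(comp_assoc fg_i) comp_idn_r.
by rewrite (reassoc e) (reassoc e').
Qed.

Lemma comp_congr f g f' g' (e : tgt C f = src C g) (e' : tgt C f' = src C g') :
  f = f' -> g = g' -> comp C f g e = comp C f' g' e'.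
Proof. by move=> ff gg; subst f' g'; apply: comp_irrelevance. Qed.

Lemma inverse_sym f g : inverse f g -> inverse g f.
Proof.
move=> [fg [gf [Efg Egf]]]; exists gf, fg.
by rewrite Efg Egf fg gf.
Qed.

Lemma inverse_src f g : inverse f g -> src C g = tgt C f.
Proof. by case. Qed.

Lemma inverse_tgt f g : inverse f g -> tgt C g = src C f.
Proof. by case=> fg [gf _]. Qed.

Lemma compVK f f' g (e : tgt C f = src C g) (e' : tgt C f' = src C (comp C f g e)) :
  inverse f f' -> comp C f' (comp C f g e) e' = g.
Proof.
move=> [ff' [f'f [_ Ef]]].
have a : tgt C (comp C f' f f'f) = src C g by rewrite tgt_comp.
rewrite -(comp_assoc a e'); move: a; rewrite Ef => a.
exact: comp_idn_l.
Qed.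

Lemma comp_injl f f' g g' (e : tgt C f = src C g) (e' : tgt C f = src C g') :
  inverse f f' -> comp C f g e = comp C f g' e' -> g = g'.
Proof.
move=> ff' E.
have a : tgt C f' = src C (comp C f g e) by rewrite src_comp (inverse_tgt ff').
have b : tgt C f' = src C (comp C f g' e') by rewrite -E.
rewrite -(compVK a ff') -(compVK b ff').
exact: comp_congr.
Qed.

Lemma inverse_unique f g g' : inverse f g -> inverse f g' -> g = g'.
Proof.
move=> fg [e' [_ [E' _]]]; have [e [_ [E _]]] := fg.
by apply: (comp_injl (e := e) (e' := e') fg); rewrite E E'.
Qed.

End Inverse.

(** Meant for [box_l] and [box_r], which the axioms make functors from boxes under vertical
    composition to vertical edges. *)
Lemma functor_inverse (A O A' O' : Type) (C : category A O)
    (C' : category A' O') (F : A -> A') (F0 : O -> O') :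
    (forall f, src C' (F f) = F0 (src C f)) ->
    (forall f, tgt C' (F f) = F0 (tgt C f)) ->
    (forall x, F (idn C x) = idn C' (F0 x)) ->
    (forall f g e e', F (comp C f g e) = comp C' (F f) (F g) e') ->
  forall f g, inverse C f g -> inverse C' (F f) (F g).
Proof.
move=> srcF tgtF idF compF f g [fg [gf [Efg Egf]]].
have fg' : tgt C' (F f) = src C' (F g) by rewrite srcF tgtF fg.
have gf' : tgt C' (F g) = src C' (F f) by rewrite srcF tgtF gf.
exists fg', gf'.
by rewrite -(compF _ _ fg) -(compF _ _ gf) Efg Egf !idF srcF tgtF.
Qed.

(** [s] and [s'] pick two adjacent sides of a box, [p] and [p'] the ends of these sides at the
    common corner. Up to the order of the sides, (1), (3), (5) and (6) are the instances at the four
    corners. *)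
Definition unique_fillers (B H V P : Type) (s : B -> H) (p : H -> P)
    (s' : B -> V) (p' : V -> P) : Prop :=
  forall x g, p x = p' g -> exists! X : B, s X = x /\ s' X = g.

Lemma unique_fillersC (B H V P : Type) (s : B -> H) (p : H -> P)
    (s' : B -> V) (p' : V -> P) :
  unique_fillers s p s' p' -> unique_fillers s' p' s p.
Proof.
move=> U g x /esym /U [X [[sX s'X] uX]].
by exists X; split=> // Y [? ?]; apply: uX.
Qed.

(* With [e = src] and [e' = tgt] (or conversely): inverting boxes in [CB]
   exchanges their two ends and inverts the side [s]. *)
Lemma unique_fillers_inverse (B H V P : Type) (CB : category B V)
    (CH : category H P) (s : B -> H) (p' : V -> P) (e e' : B -> V)
    (q q' : H -> P) :
    is_groupoid CB -> is_groupoid CH ->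
    (forall X Y, inverse CB X Y -> inverse CH (s X) (s Y)) ->
    (forall X Y, inverse CB X Y -> e Y = e' X) ->
    (forall x y, inverse CH x y -> q y = q' x) ->
  unique_fillers s q e p' -> unique_fillers s q' e' p'.
Proof.
move=> gB gH sV eV qV U x g xg.
have [y xy] := gH x.
have [X [[sX eX] uX]] := U y g (etrans (qV _ _ xy) xg).
have [Y XY] := gB X; have YX := inverse_sym XY.
exists Y; split.
  split; last by rewrite -(eV _ _ YX).
  by apply: inverse_unique (inverse_sym xy); rewrite -sX; apply: sV.
move=> Z [sZ eZ]; have [Z' ZZ'] := gB Z.
(* The inverse of any competitor [Z] fills the same corner as [X]. *)
have XZ' : X = Z'.
  apply: uX; split; last by rewrite (eV _ _ ZZ').
  by apply: inverse_unique xy; rewrite -sZ; apply: sV.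
by apply: (inverse_unique XY); rewrite XZ'; apply: inverse_sym.
Qed.

(** Here [box_t] is convertible to [box_l] of [D], and [box_r] to [box_b] of [D], so results on the
    transpose read as results on [D] without any transport. *)
Definition transpose_data (D : double_data) : double_data :=
  DoubleData (hcat D) (vcat D) (vedge_cat D) (hedge_cat D).

Lemma transpose_is_double_category (D : double_data) :
  is_double_category D -> is_double_category (transpose_data D).
Proof.
case=> iB iH iV iP tr tl bl br tc bc lc rc ich lid rid tid bid idp vid hid.
constructor=> //.
- by move=> X; symmetry; apply: bl.
- by move=> X; symmetry; apply: tl.
- by move=> X; symmetry; apply: tr.
- by move=> X; symmetry; apply: br.
- by move=> X Y Z W XY ZW XZ YW e e'; symmetry; apply: ich.
- by move=> p; symmetry; apply: idp.
Qed.

Definition transpose (T : double_groupoid) : double_groupoid :=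
  @DoubleGroupoid
    (DoubleCategory (transpose_is_double_category (double_categoryP T)))
    (@hcat_groupoid T) (@vcat_groupoid T) (@vedge_groupoid T)
    (@hedge_groupoid T).

(** This is condition (2); for [transpose T] it becomes (4). *)
Definition vfactorization (T : double_groupoid) : Prop :=
  forall (R S P : box T) (RS : box_b R = box_t S),
    box_r P = box_l (vcomp R S RS) ->
    exists! XY : box T * box T,
      box_r XY.1 = box_l R /\ box_r XY.2 = box_l S /\
      exists e : box_b XY.1 = box_t XY.2, P = vcomp XY.1 XY.2 e.

Section DoubleGroupoid.
Variable T : double_groupoid.
Let DC : is_double_category T := double_categoryP T.

Lemma box_r_inverse (X Y : box T) :
  inverse (vcat T) X Y -> inverse (vedge_cat T) (box_r X) (box_r Y).
Proof.
apply: (@functor_inverse _ _ _ _ (vcat T) (vedge_cat T) _ (@hedge_r T)).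
- exact: corner_tr DC.
- exact: corner_br DC.
- exact: box_r_id DC.
- exact: box_r_vcomp DC.
Qed.

Lemma box_l_inverse (X Y : box T) :
  inverse (vcat T) X Y -> inverse (vedge_cat T) (box_l X) (box_l Y).
Proof.
apply: (@functor_inverse _ _ _ _ (vcat T) (vedge_cat T) _ (@hedge_l T)).
- exact: corner_tl DC.
- exact: corner_bl DC.
- exact: box_l_id DC.
- exact: box_l_vcomp DC.
Qed.

(** Turning boxes upside down relates (1) to (6) when [s] is [box_r], and (5) to (3) when [s] is
    [box_l]. *)
Lemma unique_fillers_vflip (s : box T -> vedge T) (p : hedge T -> point T) :
    (forall X Y, inverse (vcat T) X Y -> inverse (vedge_cat T) (s X) (s Y)) ->
  unique_fillers s (@vedge_t T) (@box_t T) p <->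
  unique_fillers s (@vedge_b T) (@box_b T) p.
Proof.
move=> sV; split; apply: (unique_fillers_inverse (@vcat_groupoid T)
  (@vedge_groupoid T) sV); move=> ? ?.
- exact: inverse_src.
- exact: inverse_src.
- exact: inverse_tgt.
- exact: inverse_tgt.
Qed.

Lemma vacant_unique_fillers :
  vacant T <-> unique_fillers (@box_t T) (@hedge_r T) (@box_r T) (@vedge_t T).
Proof. by split=> U x g; apply: U. Qed.

Lemma vacant_vfactorization : vacant T -> vfactorization T.
Proof.
move=> vT R S P RS rP.
have corner : hedge_r (box_t P) = vedge_t (box_l R).
  by rewrite -(corner_tr DC) rP !(corner_tl DC) [box_t (vcomp _ _ _)]src_comp.
have [X [[tX rX] uX]] := vT _ _ corner.
have [X' XX'] := @vcat_groupoid T X.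
have X'P : box_b X' = box_t P by rewrite -tX; apply: inverse_tgt XX'.
have XY : box_b X = box_t (vcomp X' P X'P).
  by rewrite [RHS]src_comp; symmetry; apply: inverse_src XX'.
have PE : P = vcomp X (vcomp X' P X'P) XY.
  by symmetry; apply: compVK; apply: inverse_sym.
have RS' : vedge_b (box_l R) = vedge_t (box_l S).
  by rewrite (corner_bl DC) (corner_tl DC) RS.
(* Taking right edges in [PE] gives $l(R)\,r(Y) = r(P) = l(R)\,l(S)$, where $l(R)$ cancels. *)
have rY : box_r (vcomp X' P X'P) = box_l S.
  have e : vedge_b (box_r X) = vedge_t (box_r (vcomp X' P X'P)).
    by rewrite (corner_br DC) (corner_tr DC) XY.
  have := rP; rewrite {1}PE (box_r_vcomp DC _ e) (box_l_vcomp DC _ RS') => E.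
  have [g' rg'] := @vedge_groupoid T (box_l R).
  have e' : vedge_b (box_l R) = vedge_t (box_r (vcomp X' P X'P)) by rewrite -rX.
  apply: (comp_injl (e := e') (e' := RS') rg').
  by rewrite -[RHS]E; apply: comp_congr.
exists (X, vcomp X' P X'P); split=> /=.
  by split=> //; split=> //; exists XY.
move=> [X1 Y1] /= [rX1 [rY1 [e1 PE1]]].
(* The upper factor always has top $t(P)$, so vacancy determines it; the lower one then follows by
   cancelling [X]. *)
have X1E : X = X1.
  by apply: uX; split=> //; rewrite PE1 [RHS]src_comp.
subst X1; congr (_, _).
apply: (comp_injl (e := XY) (e' := e1) XX').
by rewrite -[LHS]PE.
Qed.

Lemma vfactorization_unique_fillers : vfactorization T ->
  unique_fillers (@box_r T) (@vedge_b T) (@box_b T) (@hedge_r T).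
Proof.
move=> F g y gy.
have [g' gg'] := @vedge_groupoid T g.
have g'g : vedge_b g' = vedge_t g by apply: inverse_tgt gg'.
have RS : box_b (id_box_v g') = box_t (id_box_v g).
  by rewrite (box_b_id DC) (box_t_id DC) g'g.
(* Both sides are the identity at $b(g)$, since $g^{-1}g$ is. *)
have rP : box_r (id_box_h y) = box_l (vcomp _ _ RS).
  rewrite (box_r_id DC) (vcomp_id_box DC g'g) [RHS]src_idn -gy.
  have [_ [e [_ E]]] := gg'.
  by rewrite /id_vedge -[LHS]E; apply: comp_irrelevance.
have [[X Y] [/= [rX [rY [XY E]]] uXY]] := F _ _ _ _ rP.
rewrite [RHS]src_idn in rX; rewrite [RHS]src_idn in rY.
exists Y; split.
  split=> //; have := congr1 (@box_b T) E.
  by rewrite [box_b (vcomp _ _ _)]tgt_comp [box_b (id_box_h _)]tgt_idn.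
move=> Z [rZ bZ]; have [W ZW] := @vcat_groupoid T Z.
have [_ [WZ [_ EWZ]]] := ZW.
have rW : box_r W = g'.
  by apply: inverse_unique gg'; rewrite -rZ; apply: box_r_inverse.
(* As $W = Z^{-1}$ and $b(Z) = y$, the pair [(W, Z)] is another factorization of $\mathbf{id}_y$. *)
suff [] : (X, Y) = (W, Z) by [].
apply: uXY => /=; rewrite ![box_l _]src_idn; split=> //; split=> //.
by exists WZ; rewrite /vcomp EWZ -[tgt _ Z]/(box_b Z) bZ.
Qed.

End DoubleGroupoid.

Theorem proposition2p2 (T : double_groupoid) :
  [<-> vacant T;
       forall (R S P : box T) (RS : box_b R = box_t S),
         box_r P = box_l (vcomp R S RS) ->
         exists! XY : box T * box T,
           box_r XY.1 = box_l R /\ box_r XY.2 = box_l S /\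
           exists e : box_b XY.1 = box_t XY.2, P = vcomp XY.1 XY.2 e;
       forall (f : vedge T) (y : hedge T), hedge_l y = vedge_b f ->
         exists! Z : box T, box_l Z = f /\ box_b Z = y;
       forall (U V Q : box T) (UV : box_r U = box_l V),
         box_b Q = box_t (hcomp U V UV) ->
         exists! WZ : box T * box T,
           box_b WZ.1 = box_t U /\ box_b WZ.2 = box_t V /\
           exists e : box_r WZ.1 = box_l WZ.2, Q = hcomp WZ.1 WZ.2 e;
       forall (f : vedge T) (x : hedge T), hedge_l x = vedge_t f ->
         exists! Z : box T, box_l Z = f /\ box_t Z = x;
       forall (g : vedge T) (y : hedge T), hedge_r y = vedge_b g ->
         exists! Z : box T, box_r Z = g /\ box_b Z = y].
Proof.
have rt_rb := unique_fillers_vflip (@hedge_r T) (@box_r_inverse T).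
have lt_lb := unique_fillers_vflip (@hedge_l T) (@box_l_inverse T).
(* On the transpose the flip is left-right in [T]; it relates (3) to (6). *)
have bl_br := @unique_fillers_vflip (transpose T) _ (@vedge_b T)
  (@box_r_inverse (transpose T)).
tfae.
- exact: vacant_vfactorization.
(* From (2) to (6), then across the bottom edge to (3). *)
- move=> /vfactorization_unique_fillers/unique_fillersC/bl_br/unique_fillersC.
  by move=> U f y /esym /U.
(* Condition (3) is vacancy of the transpose. *)
- move=> U; apply: (@vacant_vfactorization (transpose T)).
  by apply/vacant_unique_fillers => f y /esym; apply: U.
(* The transpose of (6) is (6) with its sides exchanged; two flips through (3) lead to (5). *)
- move=> /(@vfactorization_unique_fillers (transpose T)).
  by move=> /bl_br/unique_fillersC/lt_lb U f x /esym /U.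
- move=> U g y /esym.
  apply: unique_fillersC g y; apply/bl_br/unique_fillersC/lt_lb.
  by move=> f x /esym /U.
- move=> U; apply/vacant_unique_fillers/unique_fillersC/rt_rb.
  by move=> g y /esym /U.
Qed.
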